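(* Let $F=(a_0'+b_0x,\ a_1'+b_1x)$ and $G=(a_0''+b_0x,\ a_1''+b_1x)$ (coefficients in $\mathbb{Q}_2$, with the same linear coefficients $b_0,b_1$) be linear-polynomial $2$-adic systems in weak canonical form. Then $$\pi_{F,G}(n)=\frac{a_0'a_1''-a_1'a_0''+n\big((b_0-2)a_1''-(b_1-2)a_0''\big)}{(b_0-2)a_1'-(b_1-2)a_0'}$$ for all $n\in\mathbb{Z}_2$. In particular, if all the coefficients $a_0',a_1',a_0'',a_1'',b_0,b_1$ lie in $\mathbb{Q}\cap\mathbb{Z}_2$, then $\pi_{F,G}(\mathbb{Q}\cap\mathbb{Z}_2)=\mathbb{Q}\cap\mathbb{Z}_2$, and consequently $F$ is ultimately periodic on $\mathbb{Q}\cap\mathbb{Z}_2$ if and only if $G$ is ultimately periodic on $\mathbb{Q}\cap\mathbb{Z}_2$.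
   Context: For $a=\sum_{i\ge0}a_i2^i\in\mathbb{Z}_2$ with $a_i\in\{0,1\}$ let $a\,\%\,2:=a_0$. A $2$-fibred function with domain $\mathbb{Z}_2$ is a pair $F=(F[0],F[1])$ of functions $\mathbb{Z}_2\to\mathbb{Z}_2$, regarded also as a function $F:\mathbb{Z}_2\to\mathbb{Z}_2$ by $F(n)=\dfrac{F[n\%2](n)-(F[n\%2](n)\,\%\,2)}{2}$. Only the values of $F[r]$ on $r+2\mathbb{Z}_2$ matter; $F$ is linear-polynomial, written $F=(a_0+b_0x,a_1+b_1x)$, if $F[r]$ agrees on $r+2\mathbb{Z}_2$ with the polynomial $a_r+b_rx$ over $\mathbb{Q}_2$ for $r=0,1$. $F$ is in weak canonical form if $F[r](r+2\mathbb{Z}_2)\subseteq2\mathbb{Z}_2$ for $r=0,1$ (so that $F(n)=F[n\%2](n)/2$). The $F$-digit expansion of $n$ is $\psi_F(n):=(F^k(n)\,\%\,2)_{k\ge0}$. $F$ is a $2$-adic system if for all integers $k\ge0$ and all $m,n\in\mathbb{Z}_2$: $m\equiv n\pmod{2^k}$ if and only if the first $k$ entries of $\psi_F(m)$ and $\psi_F(n)$ coincide. Then $\psi_F$ is a bijection from $\mathbb{Z}_2$ onto the set of infinite $0$-$1$-sequences, and $\pi_{F,G}:=\psi_G^{-1}\circ\psi_F:\mathbb{Z}_2\to\mathbb{Z}_2$ for $2$-adic systems $F,G$. A $2$-adic system $F$ is ultimately periodic on a set $A$ if $\{n\in\mathbb{Z}_2\mid\psi_F(n)\text{ is ultimately periodic}\}=A$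 (purely periodic sequences count as ultimately periodic). *)

(* Defs.v *)
From HB Require Import structures.
From mathcomp Require Import all_boot all_order all_algebra.
From mathcomp Require Import boolp classical_sets functions.

Set Implicit Arguments.
Unset Strict Implicit.
Unset Printing Implicit Defensive.

Import GRing.Theory.

(* The ring of 2-adic integers, as the inverse limit of the rings Z/2^k: the
   component [trunc x k] is the residue of x modulo 2^k, represented by an
   integer in {0, ..., 2^k - 1}. *)
Record Z2 := MkZ2 {
  trunc : nat -> nat;
  truncP : forall k, trunc k = trunc k.+1 %% 2 ^ k
}.

Lemma Z2_ext (x y : Z2) : trunc x =1 trunc y -> x = y.
Proof.
case: x y => [f fP] [g gP] /= /funext eq_fg; move: fP gP; rewrite {}eq_fg.
by move=> fP gP; congr MkZ2; exact: Prop_irrelevance.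
Qed.

Lemma trunc_small x k : trunc x k %% 2 ^ k = trunc x k.
Proof. by rewrite [in RHS]truncP [in LHS]truncP modn_mod. Qed.

Lemma trunc_mod x i j : i <= j -> trunc x i = trunc x j %% 2 ^ i.
Proof.
move/subnK <-; elim: (j - i) => [|d IHd]; first by rewrite trunc_small.
by rewrite IHd truncP modn_dvdm // dvdn_exp2l // leq_addl.
Qed.

Definition coherent (f : nat -> nat) := forall k, f k.+1 = f k %[mod 2 ^ k].

Fact Z2_of_subproof f (fP : coherent f) k :
  f k %% 2 ^ k = (f k.+1 %% 2 ^ k.+1) %% 2 ^ k.
Proof. by rewrite modn_dvdm ?dvdn_exp2l // fP. Qed.

Definition Z2_of f (fP : coherent f) : Z2 :=
  MkZ2 (Z2_of_subproof fP).

Lemma truncS x k : trunc x k.+1 = trunc x k %[mod 2 ^ k].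
Proof. by rewrite -truncP trunc_small. Qed.

Fact Z2_cst_subproof n : coherent (fun=> n). Proof. by []. Qed.
Definition Z2_cst n := Z2_of (Z2_cst_subproof n).

Fact Z2_add_subproof x y : coherent (fun k => trunc x k + trunc y k).
Proof. by move=> k; rewrite -modnDm !truncS modnDm. Qed.
Definition Z2_add x y := Z2_of (Z2_add_subproof x y).

Fact Z2_opp_subproof x : coherent (fun k => 2 ^ k - trunc x k).
Proof.
have le k : trunc x k <= 2 ^ k.
  by rewrite -trunc_small ltnW // ltn_mod expn_gt0.
move=> k; apply/eqP; rewrite -(eqn_modDr (trunc x k.+1)) subnK //.
by rewrite -[X in _ == X]modnDmr truncS modnDmr subnK // expnS modnMl modnn.
Qed.
Definition Z2_opp x := Z2_of (Z2_opp_subproof x).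

Fact Z2_mul_subproof x y : coherent (fun k => trunc x k * trunc y k).
Proof. by move=> k; rewrite -modnMm !truncS modnMm. Qed.
Definition Z2_mul x y := Z2_of (Z2_mul_subproof x y).

HB.instance Definition _ := gen_eqMixin Z2.
HB.instance Definition _ := gen_choiceMixin Z2.

Fact Z2_addA : associative Z2_add.
Proof. by move=> x y z; apply: Z2_ext => k /=; rewrite modnDmr modnDml addnA. Qed.
Fact Z2_addC : commutative Z2_add.
Proof. by move=> x y; apply: Z2_ext => k /=; rewrite addnC. Qed.
Fact Z2_add0 : left_id (Z2_cst 0) Z2_add.
Proof. by move=> x; apply: Z2_ext => k /=; rewrite mod0n add0n trunc_small. Qed.
Fact Z2_addN : left_inverse (Z2_cst 0) Z2_opp Z2_add.
Proof.
move=> x; apply: Z2_ext => k /=; rewrite modnDml subnK ?modnn ?mod0n //.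
by rewrite -trunc_small ltnW // ltn_mod expn_gt0.
Qed.
HB.instance Definition _ :=
  GRing.isZmodule.Build Z2 Z2_addA Z2_addC Z2_add0 Z2_addN.

Fact Z2_mulA : associative Z2_mul.
Proof. by move=> x y z; apply: Z2_ext => k /=; rewrite modnMmr modnMml mulnA. Qed.
Fact Z2_mulC : commutative Z2_mul.
Proof. by move=> x y; apply: Z2_ext => k /=; rewrite mulnC. Qed.
Fact Z2_mul1 : left_id (Z2_cst 1) Z2_mul.
Proof. by move=> x; apply: Z2_ext => k /=; rewrite modnMml mul1n trunc_small. Qed.
Fact Z2_mulD : left_distributive Z2_mul Z2_add.
Proof.
by move=> x y z; apply: Z2_ext => k /=; rewrite modnMml modnDm mulnDl.
Qed.
Fact Z2_1neq0 : Z2_cst 1 != Z2_cst 0.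
Proof. by apply/eqP => /(congr1 (fun x => trunc x 1)). Qed.
HB.instance Definition _ := GRing.Zmodule_isComNzRing.Build Z2
  Z2_mulA Z2_mulC Z2_mul1 Z2_mulD Z2_1neq0.

Local Open Scope ring_scope.

Definition Z2_unit : {pred Z2} := fun x => `[< exists y : Z2, y * x = 1 >].
Definition Z2_inv (x : Z2) : Z2 :=
  if pselect (exists y : Z2, y * x = 1) is left h then sval (cid h) else x.

Fact Z2_mulV : {in Z2_unit, left_inverse 1 Z2_inv *%R}.
Proof.
move=> x xU; rewrite /Z2_inv.
by case: pselect => [h|[]]; [exact: svalP (cid h) | exact/asboolP].
Qed.
Fact Z2_unitP (x y : Z2) : y * x = 1 -> Z2_unit x.
Proof. by move=> xy1; apply/asboolP; exists y. Qed.
Fact Z2_inv_out : {in [predC Z2_unit], Z2_inv =1 id}.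
Proof.
move=> x; rewrite !inE => /negP xU; rewrite /Z2_inv.
by case: pselect => // h; case: xU; apply/asboolP.
Qed.
HB.instance Definition _ := GRing.ComNzRing_hasMulInverse.Build Z2
  Z2_mulV Z2_unitP Z2_inv_out.

Lemma trunc0 k : trunc 0 k = 0%N. Proof. exact: mod0n. Qed.
Lemma truncD x y k : trunc (x + y) k = ((trunc x k + trunc y k) %% 2 ^ k)%N.
Proof. by []. Qed.
Lemma truncM x y k : trunc (x * y) k = ((trunc x k * trunc y k) %% 2 ^ k)%N.
Proof. by []. Qed.
Lemma trunc_nat n k : trunc n%:R k = (n %% 2 ^ k)%N.
Proof.
elim: n => [|n IHn]; first by rewrite trunc0 mod0n.
by rewrite -addn1 natrD truncD IHn /= modnDm.
Qed.

Fact Z2_idomain : GRing.integral_domain_axiom Z2.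
Proof.
move=> x y xy0; apply: contraT; rewrite negb_or => /andP[x0 y0].
have nz (z : Z2) : z != 0 -> exists k, trunc z k != 0%N.
  move=> z0; apply: contrapT => /forallNP z_eq0; case/eqP: z0.
  by apply: Z2_ext => k; rewrite trunc0; apply/eqP/negPn/negP/z_eq0.
have val (z : Z2) i k : trunc z i != 0%N -> (i <= k)%N ->
    (0 < trunc z k)%N && (logn 2 (trunc z k) < i)%N.
  move=> zi ik; move: zi; rewrite (trunc_mod z ik).
  case: posnP => [->|zk]; first by rewrite mod0n.
  by rewrite ltnNge -pfactor_dvdn.
have [[i xi] [j yj]] := (nz x x0, nz y y0).
have /andP[xp xl] := val x i (i + j)%N xi (leq_addr _ _).
have /andP[yp yl] := val y j (i + j)%N yj (leq_addl _ _).
have : (2 ^ (i + j) %| trunc x (i + j) * trunc y (i + j))%N.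
  by rewrite /dvdn -truncM xy0 trunc0.
rewrite pfactor_dvdn ?muln_gt0 ?xp // lognM // leqNgt.
by rewrite -addnS leq_add // ltnW.
Qed.
HB.instance Definition _ :=
  GRing.ComUnitRing_isIntegral.Build Z2 Z2_idomain.

Notation Q2 := {fraction Z2}.
Notation "x %:F" := (@FracField.tofrac _ x).

(* The digits a_i of a = \sum_i a_i 2^i, the digits 0 and 1 being the booleans
   [false] and [true] (which coerce to the numbers 0 and 1). *)
Definition digit (a : Z2) (i : nat) : bool := odd (trunc a i.+1 %/ 2 ^ i).

Lemma trunc_digit a k :
  trunc a k = (\sum_(i < k) digit a i * 2 ^ i)%N.
Proof.
elim: k => [|k IHk]; first by rewrite big_ord0 -trunc_small modn1.
rewrite big_ord_recr /= -IHk {1}(divn_eq (trunc a k.+1) (2 ^ k)) -truncP addnC.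
congr (_ + _ * _)%N; rewrite /digit.
have : (trunc a k.+1 %/ 2 ^ k < 2)%N.
  by rewrite ltn_divLR ?expn_gt0 // -expnS -trunc_small ltn_mod expn_gt0.
by case: (_ %/ _)%N => [|[|]].
Qed.

Definition par (a : Z2) : bool := digit a 0.

(* (a - par a) / 2, cf. [halfE]. *)
Fact half_subproof a : coherent (fun k => trunc a k.+1 %/ 2)%N.
Proof.
move=> k; rewrite [in RHS](truncP a k.+1) expnSr.
by rewrite -modn_divl modn_mod.
Qed.
Definition half (a : Z2) : Z2 := Z2_of (half_subproof a).

Lemma half_mul2 a : 2%:R * half a = a - (par a)%:R.
Proof.
apply/(addIr (par a)%:R); rewrite subrK; apply: Z2_ext => k.
rewrite truncD truncM !trunc_nat /= modnMm modnDm.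
have -> : par a = odd (trunc a k.+1) :> nat.
  rewrite /par /digit expn0 divn1 -modn2.
  by rewrite (@trunc_mod a 1 k.+1) // expn1 !modn2 oddb.
by rewrite mulnC -modn2 -divn_eq -truncP.
Qed.

Lemma Q2_two_neq0 : 2%:R != 0 :> Q2.
Proof.
rewrite -[2%:R](rmorph_nat (@FracField.tofrac Z2)) tofrac_eq0.
by apply/eqP => /(congr1 (fun x => trunc x 2)); rewrite trunc_nat trunc0.
Qed.

Lemma halfE a : (half a)%:F = (a%:F - (par a)%:R) / 2%:R.
Proof.
apply: (canRL (mulfK Q2_two_neq0)); rewrite mulrC.
rewrite -[2%:R](rmorph_nat (@FracField.tofrac Z2)) -rmorphM half_mul2.
by rewrite rmorphB rmorph_nat.
Qed.

Local Open Scope classical_set_scope.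

(* [F false] and [F true] are F[0] and F[1]. *)
Definition fibred := bool -> Z2 -> Z2.

(* A fibred function F regarded as a function Z2 -> Z2. *)
Definition fib_fun (F : fibred) (n : Z2) : Z2 := half (F (par n) n).

Definition linear_polynomial (F : fibred) (a0 b0 a1 b1 : Q2) :=
  (forall n, par n = false -> (F false n)%:F = a0 + b0 * n%:F) /\
  (forall n, par n = true -> (F true n)%:F = a1 + b1 * n%:F).

Definition weak_canonical (F : fibred) :=
  forall (r : bool) (n : Z2), par n = r -> exists m, F r n = 2%:R * m.

Definition psi (F : fibred) (n : Z2) : nat -> bool :=
  fun k => par (iter k (fib_fun F) n).

Definition adic_system (F : fibred) :=
  forall (k : nat) (m n : Z2),
    (exists z : Z2, m - n = 2%:R ^+ k * z) <->
    (forall i, (i < k)%N -> psi F m i = psi F n i).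

(* The inverse of [psi G] takes the junk value 0 outside the range of [psi G],
   which is everything when G is a 2-adic system. *)
Definition piFG (F G : fibred) : Z2 -> Z2 :=
  'pinv_(fun=> 0) setT (psi G) \o psi F.

Definition ult_periodic (s : nat -> bool) :=
  exists N p, (0 < p)%N /\ forall k, (N <= k)%N -> s (k + p)%N = s k.

Definition ult_periodic_on (F : fibred) (A : set Z2) :=
  [set n | ult_periodic (psi F n)] = A.

(* The intersection of Q and Z2, inside Q2, as a subset of Z2. *)
Definition ratZ2 : set Z2 := [set n | exists q : rat, n%:F = ratr q].

(* Main.v *)
(* Write [b_r], [a_r] for the coefficients of a branch. The 2-adic system property
   forces [b_r] to be an odd 2-adic integer, so [2 - b_r] is a unit and the branch
   [n |-> (a_r + b_r n) / 2] of [F] has a unique fixed point [x_r], of parity [r],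
   with [a_r = (2 - b_r) x_r]. Let [y_r] be the fixed points for [G]. As both
   [x_1 - x_0] and [y_1 - y_0] are odd, the affine map [L] with [L x_r = y_r]
   preserves [Z2] and parity; it conjugates each branch of [F] to the branch of
   [G] with the same slope, hence [psi G (L n) = psi F n] and [L] is [piFG F G].
   The determinant in the statement is [- (2 - b_0) (2 - b_1) (x_1 - x_0)]. *)
From HB Require Import structures.
Require Import Defs.
From mathcomp Require Import all_boot all_order all_algebra.
From mathcomp Require Import boolp classical_sets functions.
From mathcomp Require Import ring.

Import GRing.Theory.
Local Open Scope classical_set_scope.
Local Open Scope ring_scope.

(** * Parity on [Z2], and odd elements as units *)

Lemma parE (a : Z2) : par a = odd (trunc a 1).
Proof. by rewrite /par /digit expn0 divn1. Qed.

Lemma parD (a b : Z2) : par (a + b) = par a (+) par b.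
Proof. by rewrite !parE truncD expn1 modn2 oddb oddD. Qed.

Lemma parM (a b : Z2) : par (a * b) = par a && par b.
Proof. by rewrite !parE truncM expn1 modn2 oddb oddM. Qed.

Lemma par_nat n : par n%:R = odd n.
Proof. by rewrite parE trunc_nat expn1 modn2 oddb. Qed.

Lemma parN (a : Z2) : par (- a) = par a.
Proof. by rewrite -mulN1r parM parE. Qed.

Lemma parB (a b : Z2) : par (a - b) = par a (+) par b.
Proof. by rewrite parD parN. Qed.

Lemma par_2M (a : Z2) : par (2 * a) = false.
Proof. by rewrite parM par_nat. Qed.

Lemma half_2M (a : Z2) : 2 * Defs.half (2 * a) = 2 * a.
Proof. by rewrite half_mul2 par_2M subr0. Qed.

Lemma Z2_two_neq0 : 2 != 0 :> Z2.
Proof. by rewrite -tofrac_eq0 rmorph_nat Q2_two_neq0. Qed.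

Lemma mulZ2_2I : injective ( *%R (2 : Z2)).
Proof. exact: mulfI Z2_two_neq0. Qed.

(** Each squaring gains a factor 2: [u ^ 2 - 1 = (u - 1) * (u + 1)] and [u + 1] is even when [u] is
    an odd power. *)
Lemma odd_exp2X (m k : nat) : odd m -> m ^ (2 ^ k) = 1 %[mod 2 ^ k].
Proof.
move=> om; elim: k => [|k IHk]; first by rewrite !modn1.
have m0 : (0 < m ^ 2 ^ k)%N by rewrite expn_gt0; case: m om {IHk}.
apply/eqP; rewrite eqn_mod_dvd; last by rewrite expn_gt0; case: m om {IHk m0}.
rewrite expnSr expnM -[X in (_ - X)%N](exp1n 2) subn_sqr dvdn_mul //.
  by rewrite -eqn_mod_dvd //; apply/eqP.
by rewrite dvdn2 addn1 /= oddX om orbT.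
Qed.

(* The inverse of an odd [a] is the limit of [a ^+ (2 ^ k - 1)]. *)
Lemma odd_unit (a : Z2) : par a -> a \is a GRing.unit.
Proof.
move=> oa.
have ot k : (0 < k)%N -> odd (trunc a k).
  by move=> k0; move: oa; rewrite parE (trunc_mod a k0) expn1 modn2 oddb.
pose f k := (trunc a k ^ (2 ^ k).-1)%N.
have fP : coherent f.
  move=> [|k]; first by rewrite !modn1.
  rewrite /f -modnXm truncS modnXm.
  (* The exponent grows by [2 ^ k.+1], which contributes a factor congruent to 1. Level 0 was set
     apart because [trunc a 0] is 0, not odd. *)
  have -> : (2 ^ k.+2).-1 = (2 ^ k.+1 + (2 ^ k.+1).-1)%N.
    by rewrite -!subn1 addnBA ?expn_gt0 // addnn -mul2n -expnS.
  by rewrite expnD -modnMml odd_exp2X ?ot // modnMml mul1n.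
apply/unitrPr; exists (Z2_of fP); apply: Z2_ext => k.
rewrite truncM /= modnMmr /f -expnS prednK ?expn_gt0 //.
by case: k => [|k]; [rewrite !modn1|rewrite odd_exp2X ?ot].
Qed.

(** * Digit expansions, fixed points of the branches and conjugation *)

Lemma psi_inj (F : fibred) : adic_system F -> injective (psi F).
Proof.
move=> HF m n mn; apply: Z2_ext => k.
have [_ /(_ (fun i _ => congr1 (fun s => s i) mn)) [z mnz]] := HF k m n.
rewrite -(subrK n m) mnz truncD truncM -natrX trunc_nat modnn mul0n mod0n.
by rewrite add0n trunc_small.
Qed.

Lemma fib_funE (F : fibred) (n : Z2) :
  weak_canonical F -> 2 * fib_fun F n = F (par n) n.
Proof. by rewrite /fib_fun; move=> /(_ _ n erefl)[m ->]; rewrite half_2M. Qed.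

(* [x] is the fixed point of the branch [n |-> (a + b n) / 2]. *)
Lemma branch_fixpoint (F : fibred) (r : bool) (a b : Q2) :
    adic_system F -> weak_canonical F ->
    (forall n, par n = r -> (F r n)%:F = a + b * n%:F) ->
  exists beta x : Z2,
    [/\ b = beta%:F, par beta, par x = r & a = (2 - beta%:F) * x%:F].
Proof.
(* Two points of parity [r] at distance 2: the difference of their images under [fib_fun F] is the
   slope [b], which is therefore in [Z2]. *)
move=> HF wcF linF; pose n0 : Z2 := r%:R; pose n1 := n0 + 2.
have p0 : par n0 = r by rewrite par_nat oddb.
have p1 : par n1 = r by rewrite parD p0 par_nat addbF.
set m0 := fib_fun F n0; set m1 := fib_fun F n1.
have E0 : 2 * m0%:F = a + b * n0%:F.
  by rewrite -linF // -[in F r n0]p0 -fib_funE // rmorphM rmorph_nat.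
have E1 : 2 * m1%:F = a + b * n1%:F.
  by rewrite -linF // -[in F r n1]p1 -fib_funE // rmorphM rmorph_nat.
have bE : b = (m1 - m0)%:F.
  apply: (mulfI Q2_two_neq0); rewrite rmorphB mulrBr E1 E0 rmorphD rmorph_nat.
  by ring.
(* With an even slope, [n0] and [n1] would share their first two digits and be congruent modulo 4,
   although they differ by 2. *)
have beta_odd : par (m1 - m0).
  apply: contraT; rewrite parB negb_add => /eqP m01.
  have [_ [[|[|//]] _|z]] := HF 2 n1 n0; first by rewrite /psi /= p1.
    exact: m01.
  rewrite /n1 addrAC subrr add0r expr2 -mulrA -[LHS]mulr1 => /mulZ2_2I.
  by move=> /(congr1 par); rewrite par_2M (par_nat 1).
set beta := m1 - m0 in bE beta_odd.
have pu : par (2 - beta) by rewrite parB par_nat beta_odd.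
have u := odd_unit _ pu.
(* Here [2 * m0 - beta * n0] is the constant term [a], and [x] solves [2 * x = a + beta * x]. *)
exists beta, ((2 - beta)^-1 * (2 * m0 - beta * n0)); split=> //.
  have := congr1 par (mulVKr u (2 * m0 - beta * n0)); rewrite parM pu /= => ->.
  by rewrite parB par_2M parM beta_odd p0.
rewrite -(rmorph_nat (@FracField.tofrac Z2)) -rmorphB -rmorphM mulVKr //.
by rewrite rmorphB !rmorphM rmorph_nat E0 bE addrK.
Qed.

(* The affine map sending the fixed points [x false], [x true] of the branches
   of [F] to those of [G] preserves parity and conjugates [F] to [G]. *)
Lemma psi_conjugate (F G : fibred) (beta x y : bool -> Z2) (w : Z2) :
    (forall n, 2 * fib_fun F n =
       (2 - beta (par n)) * x (par n) + beta (par n) * n) ->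
    (forall n, 2 * fib_fun G n =
       (2 - beta (par n)) * y (par n) + beta (par n) * n) ->
    (forall r, par (x r) = r) -> (forall r, par (y r) = r) ->
    w * (x true - x false) = y true - y false ->
  forall n, psi G (y false + (n - x false) * w) = psi F n.
Proof.
move=> FE GE px py wE.
have pw : par w by have := congr1 par wE; rewrite parM !parB !px !py andbT.
pose L n := y false + (n - x false) * w.
have Lx r : L (x r) = y r.
  case: r; rewrite /L ?subrr ?mul0r ?addr0 // mulrC wE; ring.
have parL n : par (L n) = par n by rewrite parD parM parB px py pw andbT addbF.
have GL n : fib_fun G (L n) = L (fib_fun F n).
  (* Writing [y (par n)] as [L (x (par n))] turns both parities into the same polynomial
     identity. *)
  apply: mulZ2_2I; rewrite GE parL -(Lx (par n)) /L.
  have := FE n; set r := par n; set f := fib_fun F n => fE.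
  transitivity (2 * y false - 2 * x false * w + (2 * f) * w); last by ring.
  by rewrite fE; ring.
move=> n; apply/funext => k; rewrite /psi -/(L n).
have -> : iter k (fib_fun G) (L n) = L (iter k (fib_fun F) n).
  by elim: k => //= k ->.
exact: parL.
Qed.

(** Indexing slopes and fixed points by the parity bit treats both branches at once; their
    integrality brings the recursion from [Q2] down to [Z2]. *)
Lemma adic_affine_branches (F : fibred) (a0 b0 a1 b1 : Q2) :
    adic_system F -> linear_polynomial F a0 b0 a1 b1 -> weak_canonical F ->
  exists beta x : bool -> Z2,
    [/\ forall r, (if r then b1 else b0) = (beta r)%:F,
        forall r, (if r then a1 else a0) = (2 - (beta r)%:F) * (x r)%:F,
        forall r, par (beta r), forall r, par (x r) = r
      & forall n, 2 * fib_fun F n =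
          (2 - beta (par n)) * x (par n) + beta (par n) * n].
Proof.
move=> HF [lin0 lin1] wcF.
have [B0 [x0 [b0E pB0 px0 a0E]]] := branch_fixpoint _ _ _ _ HF wcF lin0.
have [B1 [x1 [b1E pB1 px1 a1E]]] := branch_fixpoint _ _ _ _ HF wcF lin1.
exists (fun r => if r then B1 else B0), (fun r => if r then x1 else x0).
split=> [[]|[]|[]|[]|n] //; apply/eqP; rewrite fib_funE // -tofrac_eq.
rewrite rmorphD !rmorphM rmorphB rmorph_nat.
case pn: (par n) => /=; first by rewrite lin1 // -b1E a1E -b1E.
by rewrite lin0 // -b0E a0E -b0E.
Qed.

(** * The closed formula for [piFG] *)

Lemma affine_interpolation (K : fieldType) (b0 b1 x0 x1 y0 y1 n : K)
    (a0' := (2 - b0) * x0) (a1' := (2 - b1) * x1)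
    (a0'' := (2 - b0) * y0) (a1'' := (2 - b1) * y1) :
    2 - b0 != 0 -> 2 - b1 != 0 -> x1 - x0 != 0 ->
  (b0 - 2) * a1' - (b1 - 2) * a0' != 0 /\
  y0 + (n - x0) * ((y1 - y0) / (x1 - x0)) =
    (a0' * a1'' - a1' * a0'' + n * ((b0 - 2) * a1'' - (b1 - 2) * a0''))
    / ((b0 - 2) * a1' - (b1 - 2) * a0').
Proof.
move=> u0 u1 v; have DE : (b0 - 2) * a1' - (b1 - 2) * a0' =
    - ((2 - b0) * (2 - b1) * (x1 - x0)) by rewrite /a0' /a1'; ring.
have D0 : (b0 - 2) * a1' - (b1 - 2) * a0' != 0.
  by rewrite DE oppr_eq0 !mulf_neq0.
(* The left side is the line through [(x0, y0)] and [(x1, y1)]; once the determinant is cleared,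
   only the denominator [x1 - x0] remains. *)
split=> //; apply: (canRL (mulfK D0)).
by rewrite DE /a0' /a1' /a0'' /a1''; field.
Qed.

Lemma piFG_formula (F G : fibred) (a0' a1' a0'' a1'' b0 b1 : Q2) :
    adic_system F -> adic_system G ->
    linear_polynomial F a0' b0 a1' b1 -> linear_polynomial G a0'' b0 a1'' b1 ->
    weak_canonical F -> weak_canonical G ->
  [/\ (b0 - 2) * a1' - (b1 - 2) * a0' != 0,
      forall n, psi G (piFG F G n) = psi F n
    & forall n : Z2, (piFG F G n)%:F =
        (a0' * a1'' - a1' * a0'' + n%:F * ((b0 - 2) * a1'' - (b1 - 2) * a0''))
        / ((b0 - 2) * a1' - (b1 - 2) * a0')].
Proof.
move=> HF HG linF linG wcF wcG.
have [beta [x [bE aE pb px FE]]] := adic_affine_branches _ _ _ _ _ HF linF wcF.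
have [beta2 [y [bE2 aE2 _ py GE]]] := adic_affine_branches _ _ _ _ _ HG linG wcG.
have eq_beta : beta2 = beta.
  by apply/funext => r; apply/eqP; rewrite -tofrac_eq -bE -bE2.
rewrite {beta2 bE2}eq_beta in aE2 GE.
have nzF z : par z -> z%:F != 0 :> Q2.
  by move=> pz; rewrite tofrac_eq0; apply: contraTneq pz => ->; rewrite (par_nat 0).
have dx_odd : par (x true - x false) by rewrite parB !px.
have [w wE] : exists w, w * (x true - x false) = y true - y false.
  by exists ((y true - y false) / (x true - x false)); rewrite divrK ?odd_unit.
have psiL := psi_conjugate _ _ _ _ _ _ FE GE px py wE.
(* By [psiL], [psi F n] lies in the range of [psi G], so the partial inverse returns the true
   preimage and not the junk value 0. *)
have piE n : piFG F G n = y false + (n - x false) * w.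
  by rewrite /piFG /= -psiL pinvKV ?in_setT // => ? ? _ _; apply: psi_inj.
have u r : 2 - (beta r)%:F != 0 :> Q2.
  rewrite -(rmorph_nat (@FracField.tofrac Z2)) -rmorphB nzF //.
  by rewrite parB par_nat pb.
have v : (x true)%:F - (x false)%:F != 0 :> Q2 by rewrite -rmorphB nzF.
have [/= b1E b0E] := (bE true, bE false).
have [/= a1E a0E] := (aE true, aE false).
have [/= a1E2 a0E2] := (aE2 true, aE2 false).
have formula n := affine_interpolation _ _ _ _ _ (y false)%:F (y true)%:F n%:F
  (u false) (u true) v.
rewrite a1E a0E a1E2 a0E2 b0E b1E.
split=> [|n|n]; [by case: (formula 0)|by rewrite piE psiL|].
have wFE : w%:F = ((y true)%:F - (y false)%:F) / ((x true)%:F - (x false)%:F).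
  by apply: (canRL (mulfK v)); rewrite -!rmorphB -rmorphM wE.
have [_ <-] := formula n.
by rewrite piE rmorphD rmorphM rmorphB /= wFE.
Qed.

(** * Rational elements of [Q2] and ultimate periodicity *)

Lemma Q2_int_eq0 (z : int) : (z%:~R == 0 :> Q2) = (z == 0).
Proof.
have nat0 n : (n%:R == 0 :> Q2) = (n == 0)%N.
  rewrite -(rmorph_nat (@FracField.tofrac Z2)) tofrac_eq0.
  (* Since [n < 2 ^ n], the residue at level [n] is [n] itself. *)
  apply/eqP/eqP => [/(congr1 (fun a => trunc a n))|-> //].
  by rewrite trunc_nat trunc0 modn_small // ltn_expl.
by case: z => n; rewrite ?NegzE ?rmorphN ?oppr_eq0 -?pmulrn nat0.
Qed.

Lemma Q2_ratr_div (p q : int) : ratr (p%:~R / q%:~R) = p%:~R / q%:~R :> Q2.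
Proof.
have [->|q0] := eqVneq q 0; first by rewrite !invr0 !mulr0 (ratr_nat _ 0).
set t := _ / _ : rat.
have tE : numq t * q = p * denq t.
  apply: (intr_inj (R := rat)); rewrite !rmorphM /= numqE -/t.
  by rewrite /t mulrAC divfK ?intr_eq0.
apply/eqP; rewrite /ratr eqr_div ?Q2_int_eq0 ?denq_neq0 //.
by rewrite -!rmorphM /= tE.
Qed.

(** A predicate on the field [Q2], so that it can be registered as a division subring and applied to
    the closed formula. *)
Definition ratQ2 : {pred Q2} := fun x => `[< exists q : rat, x = ratr q >].

Lemma ratQ2P (x : Q2) :
  reflect (exists p q : int, x = p%:~R / q%:~R) (x \in ratQ2).
Proof.
apply: (iffP (asboolP _)) => [[q ->]|[p [q ->]]].
  by exists (numq q), (denq q).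
by exists (p%:~R / q%:~R); rewrite Q2_ratr_div.
Qed.

Fact ratQ2_divring_closed : divring_closed ratQ2.
Proof.
split; first by apply/ratQ2P; exists 1, 1; rewrite divr1.
- move=> x y /ratQ2P[p [q xE]] /ratQ2P[p' [q' yE]]; apply/ratQ2P.
  (* [ratQ2P] admits zero denominators, for which the fraction is 0 by the convention on
     inverses. *)
  have [q0|q0] := eqVneq q 0; first exists (- p'), q'.
    by rewrite xE yE q0 invr0 mulr0 sub0r rmorphN mulNr.
  have [q0'|q0'] := eqVneq q' 0; first exists p, q.
    by rewrite xE yE q0' invr0 mulr0 subr0.
  exists (p * q' - p' * q), (q * q'); rewrite xE yE -mulNr addf_div ?Q2_int_eq0 //.
  by rewrite mulNr -!rmorphM -rmorphB.
- move=> x y /ratQ2P[p [q ->]] /ratQ2P[p' [q' ->]]; apply/ratQ2P.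
  by exists (p * q'), (q * p'); rewrite invf_div mulf_div -!rmorphM.
Qed.
HB.instance Definition _ := GRing.isDivringClosed.Build Q2 ratQ2
  ratQ2_divring_closed.

Lemma piFG_ratZ2 (F G : fibred) (a0' a1' a0'' a1'' b0 b1 : Q2) (n : Z2) :
    adic_system F -> adic_system G ->
    linear_polynomial F a0' b0 a1' b1 -> linear_polynomial G a0'' b0 a1'' b1 ->
    weak_canonical F -> weak_canonical G ->
    {subset [:: a0'; a1'; a0''; a1''; b0; b1] <= ratQ2} ->
  ratZ2 n -> ratZ2 (piFG F G n).
Proof.
move=> HF HG linF linG wcF wcG rat_coef rat_n.
have [_ _ piE] := piFG_formula _ _ _ _ _ _ _ _ HF HG linF linG wcF wcG.
suff: (piFG F G n)%:F \in ratQ2 by move/asboolP.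
have nR : n%:F \in ratQ2 by apply/asboolP.
have [a0R a1R] : a0' \in ratQ2 /\ a1' \in ratQ2.
  by split; apply: rat_coef; rewrite !inE eqxx ?orbT.
have [c0R c1R] : a0'' \in ratQ2 /\ a1'' \in ratQ2.
  by split; apply: rat_coef; rewrite !inE eqxx ?orbT.
have [b0R b1R] : b0 \in ratQ2 /\ b1 \in ratQ2.
  by split; apply: rat_coef; rewrite !inE eqxx ?orbT.
by rewrite piE rpred_div //;
   repeat first [ done | exact: rpred_nat | apply: rpredB | apply: rpredD
                | apply: rpredM ].
Qed.

(** The maps [piFG F G] and [piFG G F] carry digit expansions over unchanged, so their composite is
    the identity by injectivity of [psi G], and periodicity moves along them. *)
Lemma piFG_image_ult_periodic (F G : fibred) :
    adic_system G ->
    (forall n, psi G (piFG F G n) = psi F n) ->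
    (forall n, psi F (piFG G F n) = psi G n) ->
    (forall n, ratZ2 n -> ratZ2 (piFG F G n)) ->
    (forall n, ratZ2 n -> ratZ2 (piFG G F n)) ->
  piFG F G @` ratZ2 = ratZ2 /\
  (ult_periodic_on F ratZ2 -> ult_periodic_on G ratZ2).
Proof.
move=> HG psiFG psiGF ratFG ratGF.
have piK n : piFG F G (piFG G F n) = n.
  by apply: (psi_inj _ HG); rewrite psiFG psiGF.
split=> [|perF]; apply/seteqP; split=> n /=.
- by case=> m /ratFG + <-.
- by move=> rat_n; exists (piFG G F n); [exact: ratGF|exact: piK].
- rewrite -psiGF => per_n; rewrite -(piK n); apply: ratFG.
  by rewrite -perF.
- by move=> /ratGF; rewrite -perF /= psiGF.
Qed.

Theorem theorem7p14 (F G : fibred) (a0' a1' a0'' a1'' b0 b1 : Q2)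
    (HF : adic_system F) (HG : adic_system G)
    (linF : linear_polynomial F a0' b0 a1' b1)
    (linG : linear_polynomial G a0'' b0 a1'' b1)
    (wcF : weak_canonical F) (wcG : weak_canonical G) :
  [/\ (b0 - 2) * a1' - (b1 - 2) * a0' != 0,
      forall n : Z2,
        (piFG F G n)%:F =
          (a0' * a1'' - a1' * a0''
             + n%:F * ((b0 - 2) * a1'' - (b1 - 2) * a0''))
          / ((b0 - 2) * a1' - (b1 - 2) * a0')
    & (forall c, c \in [:: a0'; a1'; a0''; a1''; b0; b1] ->
         exists2 m : Z2, ratZ2 m & c = m%:F) ->
      piFG F G @` ratZ2 = ratZ2 /\
      (ult_periodic_on F ratZ2 <-> ult_periodic_on G ratZ2)].
Proof.
have [D0 psiFG piE] := piFG_formula _ _ _ _ _ _ _ _ HF HG linF linG wcF wcG.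
have [_ psiGF _] := piFG_formula _ _ _ _ _ _ _ _ HG HF linG linF wcG wcF.
split=> // rat_coef.
have ratFG : {subset [:: a0'; a1'; a0''; a1''; b0; b1] <= ratQ2}.
  by move=> c /rat_coef[m rat_m ->]; apply/asboolP.
have ratGF : {subset [:: a0''; a1''; a0'; a1'; b0; b1] <= ratQ2}.
  (* Exchanging [F] and [G] only permutes the list of coefficients. *)
  have /permEl/perm_mem mem_swap :=
    perm_catCA [:: a0''; a1''] [:: a0'; a1'] [:: b0; b1].
  by move=> c; rewrite (mem_swap c); apply: ratFG.
have {}ratFG n := piFG_ratZ2 _ _ _ _ _ _ _ _ n HF HG linF linG wcF wcG ratFG.
have {}ratGF n := piFG_ratZ2 _ _ _ _ _ _ _ _ n HG HF linG linF wcG wcF ratGF.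
have [imFG perFG] := piFG_image_ult_periodic _ _ HG psiFG psiGF ratFG ratGF.
by have [_ perGF] := piFG_image_ult_periodic _ _ HF psiGF psiFG ratGF ratFG.
Qed.
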